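(* Let $G$ be an infinite group. Then: (i) $G$ is $\mathfrak{Z}$-cofinite if and only if every countable subgroup of $G$ is $\mathfrak{Z}$-cofinite; (ii) $G$ is $\mathfrak{C}'$-cofinite if and only if every countable subgroup of $G$ is $\mathfrak{C}'$-cofinite; (iii) $G$ is $\mathfrak{Z}_{mon}$-cofinite if and only if every countable subgroup of $G$ is $\mathfrak{Z}_{mon}$-cofinite.
   Context: For a group $G$ with neutral element $e$, let $G[x]=G*\langle x\rangle$ be the free product of $G$ with the infinite cyclic group $\langle x\rangle$; for $w\in G[x]$ and $g\in G$ let $w(g)\in G$ be obtained by replacing $x$ with $g$, and put $E_w=\{g\in G: w(g)=e\}$. The Zariski topology $\mathfrak{Z}_G$ is the topology on $G$ having $\{E_w : w\in G[x]\}$ as a subbase of its closed sets. The monomial topology $\mathfrak{Z}_{mon,G}$ is the topology having as a subbase of its closed sets all sets $\{x\in G: gx^n=e\}$ with $g\in G$, $n\in\mathbb{N}$. The topology $\mathfrak{C}'_G$ is the topology having as a subbase of its closed sets all singletons together with all cosets $hC_G(g)$, $g,h\in G$, where $C_G(g)$ is the centralizer of $g$ in $G$. The cofinite topology on $G$ is the one whose closed sets are exactly $G$ and the finite subsets of $G$. A group $G$ is $\mathfrak{Z}$-cofinite (resp. $\mathfrak{C}'$-cofinite, $\mathfrak{Z}_{mon}$-cofinite) if $\mathfrak{Z}_G$ (resp. $\mathfrak{C}'_G$, $\mathfrak{Z}_{mon,G}$) is the cofinite topology on $G$. *)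

(* Defs.v *)
From HB Require Import structures.
From mathcomp Require Import all_boot all_order all_algebra generic_quotient.
From mathcomp Require Import all_classical topology.

Set Implicit Arguments.
Unset Strict Implicit.
Unset Printing Implicit Defensive.

Local Open Scope group_scope.
Local Open Scope classical_set_scope.
Local Open Scope quotient_scope.

(* The free product of two groups, as the monoid of words over G + H modulo
   the least congruence that makes both canonical injections morphisms. *)
Section FreeProduct.
Variables G H : groupType.

Local Notation word := (seq (G + H)%type).

Inductive fp_eqv : word -> word -> Prop :=
| fp_eqv_refl u : fp_eqv u u
| fp_eqv_sym u v : fp_eqv u v -> fp_eqv v u
| fp_eqv_trans v u w : fp_eqv u v -> fp_eqv v w -> fp_eqv u w
| fp_eqv_cat u u' v v' :
    fp_eqv u u' -> fp_eqv v v' -> fp_eqv (u ++ v) (u' ++ v')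
| fp_eqv_inl1 : fp_eqv [:: inl 1] [::]
| fp_eqv_inr1 : fp_eqv [:: inr 1] [::]
| fp_eqv_inlM a b : fp_eqv [:: inl a; inl b] [:: inl (a * b)]
| fp_eqv_inrM a b : fp_eqv [:: inr a; inr b] [:: inr (a * b)].

Definition fp_eqvb (u v : word) : bool := `[< fp_eqv u v >].

Fact fp_eqvb_refl : reflexive fp_eqvb.
Proof. by move=> u; apply/asboolP; exact: fp_eqv_refl. Qed.

Fact fp_eqvb_sym : symmetric fp_eqvb.
Proof. by move=> u v; apply/asboolP/asboolP; exact: fp_eqv_sym. Qed.

Fact fp_eqvb_trans : transitive fp_eqvb.
Proof.
by move=> v u w /asboolP uv /asboolP vw; apply/asboolP; exact: fp_eqv_trans vw.
Qed.

Definition fp_equiv : equiv_rel word :=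
  EquivRel fp_eqvb fp_eqvb_refl fp_eqvb_sym fp_eqvb_trans.

Definition free_product : Type := {eq_quot fp_equiv}.

HB.instance Definition _ := Choice.on free_product.
HB.instance Definition _ := EqQuotient.on free_product.

Definition fp_class (u : word) : free_product := \pi_free_product u.

Lemma fp_classP u v : reflect (fp_eqv u v) (fp_class u == fp_class v).
Proof.
rewrite /fp_class; have -> : (\pi_free_product u == \pi_free_product v) = fp_eqvb u v.
  exact: (@eqmodE _ fp_equiv).
exact: asboolP.
Qed.

Lemma fp_class_eq u v : fp_eqv u v -> fp_class u = fp_class v.
Proof. by move=> /fp_classP/eqP. Qed.

Lemma fp_classK : cancel repr fp_class.
Proof. exact: reprK. Qed.

Lemma repr_fp_class u : fp_eqv (repr (fp_class u)) u.
Proof. by apply/fp_classP; rewrite fp_classK. Qed.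

Definition fp_inv_letter (a : G + H) : G + H :=
  match a with inl g => inl g^-1 | inr h => inr h^-1 end.

Definition fp_inv_word (u : word) : word := rev (map fp_inv_letter u).

Definition fp_one : free_product := fp_class [::].
Definition fp_mul (x y : free_product) : free_product :=
  fp_class (repr x ++ repr y).
Definition fp_inv (x : free_product) : free_product :=
  fp_class (fp_inv_word (repr x)).

Lemma fp_class_cat u v : fp_class (u ++ v) = fp_mul (fp_class u) (fp_class v).
Proof.
apply: fp_class_eq; apply: fp_eqv_sym.
by apply: fp_eqv_cat; exact: repr_fp_class.
Qed.

Fact fp_mulA : associative fp_mul.
Proof.
move=> x y z; rewrite -[x]fp_classK -[y]fp_classK -[z]fp_classK.
by rewrite -!fp_class_cat catA.
Qed.

Fact fp_mul1 : left_id fp_one fp_mul.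
Proof. by move=> x; rewrite -[x]fp_classK -fp_class_cat. Qed.

Fact fp_mulr1 : right_id fp_one fp_mul.
Proof. by move=> x; rewrite -[x]fp_classK -fp_class_cat cats0. Qed.

Lemma fp_eqv_invl u : fp_eqv (fp_inv_word u ++ u) [::].
Proof.
elim: u => [|a u IHu]; first exact: fp_eqv_refl.
rewrite /fp_inv_word /= rev_cons -cats1 -catA -/(fp_inv_word u).
apply: fp_eqv_trans IHu; apply: fp_eqv_cat; first exact: fp_eqv_refl.
change (fp_eqv (([:: fp_inv_letter a] ++ [:: a]) ++ u) ([::] ++ u)).
apply: fp_eqv_cat; last exact: fp_eqv_refl.
case: a => a /=.
- by apply: fp_eqv_trans (fp_eqv_inlM _ _) _; rewrite mulVg; exact: fp_eqv_inl1.
- by apply: fp_eqv_trans (fp_eqv_inrM _ _) _; rewrite mulVg; exact: fp_eqv_inr1.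
Qed.

Lemma fp_inv_wordK : involutive fp_inv_word.
Proof.
move=> u; rewrite /fp_inv_word map_rev revK -map_comp -[RHS]map_id.
by apply: eq_map => -[] a /=; rewrite invgK.
Qed.

Fact fp_mulV : left_inverse fp_one fp_inv fp_mul.
Proof.
move=> x; rewrite -{2}[x]fp_classK -fp_class_cat.
by apply: fp_class_eq; exact: fp_eqv_invl.
Qed.

Fact fp_mulrV : right_inverse fp_one fp_inv fp_mul.
Proof.
move=> x; rewrite -{1}[x]fp_classK -fp_class_cat.
apply: fp_class_eq; rewrite -{1}[repr x]fp_inv_wordK; exact: fp_eqv_invl.
Qed.

HB.instance Definition _ := isGroup.Build free_product
  fp_mulA fp_mul1 fp_mulr1 fp_mulV fp_mulrV.

Definition fp_inl (g : G) : free_product := fp_class [:: inl g].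
Definition fp_inr (h : H) : free_product := fp_class [:: inr h].

Fact fp_inl_morphism : monoid_morphism fp_inl.
Proof.
split=> [|a b]; first exact/fp_class_eq/fp_eqv_inl1.
by rewrite -[RHS]fp_class_cat; apply/fp_class_eq/fp_eqv_sym/fp_eqv_inlM.
Qed.
HB.instance Definition _ := isUMagmaMorphism.Build G free_product fp_inl
  fp_inl_morphism.

Fact fp_inr_morphism : monoid_morphism fp_inr.
Proof.
split=> [|a b]; first exact/fp_class_eq/fp_eqv_inr1.
by rewrite -[RHS]fp_class_cat; apply/fp_class_eq/fp_eqv_sym/fp_eqv_inrM.
Qed.
HB.instance Definition _ := isUMagmaMorphism.Build H free_product fp_inr
  fp_inr_morphism.

Section Copairing.
Variables (K : groupType) (f : G -> K) (f' : H -> K).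

Definition fp_letter (a : G + H) : K :=
  match a with inl g => f g | inr h => f' h end.

(* The morphism out of the free product with components f and f'. *)
Definition fp_case (x : free_product) : K := \prod_(a <- repr x) fp_letter a.

Hypotheses (fM : monoid_morphism f) (f'M : monoid_morphism f').

Lemma fp_case_class u : fp_case (fp_class u) = \prod_(a <- u) fp_letter a.
Proof.
have eqvE v w : fp_eqv v w ->
    \prod_(a <- v) fp_letter a = \prod_(a <- w) fp_letter a.
  elim=> {v w} [//|v w _ -> //|v w w' _ -> _ -> //| | | | a b | a b].
  - by move=> v v' w w' _ IHv _ IHw; rewrite !big_cat IHv IHw.
  - by rewrite big_seq1 big_nil /= fM.1.
  - by rewrite big_seq1 big_nil /= f'M.1.
  - by rewrite big_cons !big_seq1 /= fM.2.
  - by rewrite big_cons !big_seq1 /= f'M.2.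
exact/eqvE/repr_fp_class.
Qed.

Lemma fp_case_morphism : monoid_morphism fp_case.
Proof.
split=> [|x y]; first by rewrite fp_case_class big_nil.
by rewrite [LHS]fp_case_class big_cat.
Qed.

Lemma fp_case_inl g : fp_case (fp_inl g) = f g.
Proof. by rewrite fp_case_class big_seq1. Qed.

Lemma fp_case_inr h : fp_case (fp_inr h) = f' h.
Proof. by rewrite fp_case_class big_seq1. Qed.

Lemma fp_case_unique (F : free_product -> K) : monoid_morphism F ->
  (forall g, F (fp_inl g) = f g) -> (forall h, F (fp_inr h) = f' h) ->
  F =1 fp_case.
Proof.
move=> FM Fl Fr x; rewrite -[x]fp_classK fp_case_class.
elim: (repr x) => [|a u IHu]; first by rewrite big_nil FM.1.
rewrite big_cons -cat1s fp_class_cat [LHS]FM.2 IHu; congr (_ * _).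
by case: a => a; [exact: Fl | exact: Fr].
Qed.

End Copairing.
End FreeProduct.

(* The infinite cyclic group <x>, written multiplicatively: the integer n
   stands for x ^ n. *)
Definition infinite_cyclic : Type := int.

HB.instance Definition _ := Choice.on infinite_cyclic.
HB.instance Definition _ := isGroup.Build infinite_cyclic
  (@GRing.addrA int) (@GRing.add0r int) (@GRing.addr0 int)
  (@GRing.addNr int) (@GRing.addrN int).

Definition gexpz (G : groupType) (g : G) (n : infinite_cyclic) : G :=
  match n with Posz k => g ^+ k | Negz k => g ^- k.+1 end.

Lemma gexpz_succ (G : groupType) (g : G) (n : int) :
  gexpz g (n + 1)%R = gexpz g n * g.
Proof.
case: n => [k|[|k]]; first by rewrite -PoszD addn1 /= expgSr.
  by rewrite /= mulVg.
have -> : (Negz k.+1 + 1)%R = Negz k.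
  by rewrite !NegzE -[k.+2]addn1 PoszD GRing.opprD GRing.addrNK.
by rewrite /= -!expVgn [in RHS]expgSr mulgVK.
Qed.

Lemma gexpz_morphism (G : groupType) (g : G) : monoid_morphism (gexpz g).
Proof.
split=> // m n; rewrite -[m * n]/(m + n : int)%R.
have hS (k : nat) (p : int) : gexpz g (p + k%:Z)%R = gexpz g p * g ^+ k.
  elim: k => [|k IHk]; first by rewrite GRing.addr0 mulg1.
  by rewrite -addn1 PoszD GRing.addrA gexpz_succ IHk addn1 expgSr mulgA.
case: n => [k|k]; first exact: hS.
apply: (mulIg (g ^+ k.+1)); rewrite -hS NegzE GRing.subrK.
by rewrite -NegzE /= mulgVK.
Qed.

(* G[x], and w(g) as the image of w under the morphism G[x] -> G that is the
   identity on G and sends x to g. *)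
Definition group_words (G : groupType) : groupType :=
  free_product G infinite_cyclic.

Definition word_eval (G : groupType) (w : group_words G) (g : G) : G :=
  fp_case (@id G) (gexpz g) w.

Lemma word_eval_morphism (G : groupType) (g : G) :
  monoid_morphism (fun w : group_words G => word_eval w g).
Proof. exact: (fp_case_morphism _ (gexpz_morphism g)). Qed.

Lemma word_eval_const (G : groupType) (a g : G) :
  word_eval (fp_inl infinite_cyclic a) g = a.
Proof. exact: (fp_case_inl _ (gexpz_morphism g)). Qed.

Lemma word_eval_var (G : groupType) (g : G) (n : infinite_cyclic) :
  word_eval (fp_inr G n) g = gexpz g n.
Proof. exact: (fp_case_inr _ (gexpz_morphism g)). Qed.

Definition solution_set (G : groupType) (w : group_words G) : set G :=
  [set g | word_eval w g = 1].

(* T with the topology that has S as a subbase of its closed sets. *)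
Definition closed_subbase_space (T : choiceType) (S : set (set T)) : Type := T.

HB.instance Definition _ (T : choiceType) (S : set (set T)) :=
  Choice.on (closed_subbase_space S).
HB.instance Definition _ (T : choiceType) (S : set (set T)) :=
  @isSubBaseTopological.Build (closed_subbase_space S) (set T) S (@setC T).

Definition cofinite_topology (X : topologicalType) : Prop :=
  forall A : set X, closed A <-> A = setT \/ finite_set A.

Definition centralizer (G : groupType) (g : G) : set G :=
  [set c | commute c g].

Definition zariski_subbase (G : groupType) : set (set G) :=
  range (@solution_set G).

Definition monomial_subbase (G : groupType) : set (set G) :=
  [set A | exists (g : G) (n : nat), A = [set x | g * x ^+ n = 1]].

Definition centralizer_subbase (G : groupType) : set (set G) :=
  [set A | (exists a : G, A = [set a]) \/
           (exists g h : G, A = [set h * c | c in centralizer g])].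

Definition zariski_cofinite (G : groupType) : Prop :=
  cofinite_topology (closed_subbase_space (@zariski_subbase G)).

Definition centralizer_cofinite (G : groupType) : Prop :=
  cofinite_topology (closed_subbase_space (@centralizer_subbase G)).

Definition monomial_cofinite (G : groupType) : Prop :=
  cofinite_topology (closed_subbase_space (@monomial_subbase G)).

(* A subgroup as a group in its own right. *)
Section Subgroup.
Variables (G : groupType) (H : groupClosed G).

Definition subgroup_type : Type := {x : G | x \in H}.

HB.instance Definition _ := SubChoice.on subgroup_type.

Fact subgroup_closed : group_closed (fun x : G => x \in H).
Proof.
split; first exact: gpred1.
by move=> x y xH yH; apply: (@gpredM _ H) => //; exact: gpredVr.
Qed.

HB.instance Definition _ :=
  SubChoice_isSubGroup.Build G (fun x : G => x \in H) subgroup_type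
    subgroup_closed.
End Subgroup.

(* Main.v *)
From HB Require Import structures.
Require Import Defs.
From mathcomp Require Import all_boot all_classical.
From mathcomp Require Import finmap topology ssrint.

(** All three topologies are given by a subbase of closed sets that contains
    the singletons, so each one is cofinite exactly when every subbasic set is
    finite or the whole group ([cofinite_closed_subbaseP]).  This criterion
    passes between [G] and its subgroups because each subbasic set is described
    by finitely many elements of the group (the coefficients of a word, or [g]
    and [h] for a coset [hC(g)]):
    - a description over a subgroup [H] is also one over [G], so every subbasic
      set of [H] is the trace on [H] of a subbasic set of [G];
    - a description over [G] is also one over any subgroup that contains its
      finitely many parameters.
    By the first point, cofiniteness is inherited by all subgroups.  For the
    converse, suppose that a subbasic set [A] of [G] is infinite and misses
    [z].  The subgroup generated by the parameters of [A], by [z] and by an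
    injective sequence in [A] is countable, the trace of [A] on it is subbasic
    by the second point, and this trace is again infinite and misses [z].
    [cofinite_countable_subgroups] carries out this argument for any assignment
    of subbases to groups that has the two properties; the remaining lemmas
    check them for words, for cosets of centralizers and for the equations
    [g * x ^+ n = 1]. *)

Set Implicit Arguments.
Unset Strict Implicit.
Unset Printing Implicit Defensive.

Local Open Scope classical_set_scope.
Local Open Scope group_scope.

(** * Subbases of the cofinite topology *)

(** A proper closed set is an intersection of finite unions of subbasic sets;
    one of these unions is not the whole space, so it is a finite union of
    finite sets. *)
Lemma cofinite_closed_subbaseP (T : choiceType) (S : set (set T)) :
  (forall x, S [set x]) ->
  cofinite_topology (closed_subbase_space S) <->
  (forall A, S A -> A = setT \/ finite_set A).
Proof.
move=> S1; have subbase_closed (A : set (closed_subbase_space S)) :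
    S A -> closed A.
  move=> SA; rewrite -openC; exists [set ~` A]; last by rewrite bigcup_set1.
  by move=> _ ->; exact: (@finI_from1 (set T) T S (@setC T) A SA).
split=> [cofT A SA|finS A]; first exact: (iffLR (cofT A) (subbase_closed A SA)).
split=> [|[->|]]; last 2 first.
- exact: closedT.
- move=> finA; rewrite -[A]image_id -bigcup_imset1.
  apply: closed_bigcup => // x _; exact: (subbase_closed _ (S1 x)).
rewrite -openC => -[/= opens sub_opens openE].
have [allA|/existsNP[x nAx]] := pselect (forall x, A x).
  by left; apply/seteqP; split.
(* [U] is a basic open set around [x]: a finite intersection of complements
   of subbasic sets.  None of these subbasic sets is the whole space, as [x]
   lies outside all of them. *)
right; have [U opensU Ux] : (\bigcup_(U in opens) U) x by rewrite openE.
have [Bs sub_Bs BsE] := sub_opens U opensU.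
have : finite_set (\bigcup_(B in [set` Bs]) B).
  apply: bigcup_finite => // B BsB.
  have /set_mem SB := sub_Bs B BsB.
  have [BT|//] := finS B SB.
  by move: Ux; rewrite -BsE => /(_ B BsB) /=; rewrite BT => /(_ I).
apply: sub_finite_set => y Ay; apply: contrapT => nBsy.
suff : (~` A) y by [].
rewrite -openE; exists U => //; rewrite -BsE => B BsB By.
by apply: nBsy; exists B.
Qed.

(** * Generated subgroups *)

Section GeneratedSubgroup.
Variables (G : groupType) (I : choiceType) (F : I -> G).

(** Products of generators and of their inverses, coded by finite sequences
    over the index type, so that the subgroup generated by a countable family
    is an image of a countable type. *)
Definition signed_product (s : seq (I * bool)) : G :=
  \prod_(a <- s) (if a.2 then (F a.1)^-1 else F a.1).

Definition generated : {pred G} := fun x => `[< range signed_product x >].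

Fact generated1 : 1 \in generated.
Proof. by apply/asboolP; exists [::] => //; exact: big_nil. Qed.

Fact generatedM : mulg_closed generated.
Proof.
move=> _ _ /asboolP[s _ <-] /asboolP[t _ <-].
apply/asboolP; exists (s ++ t) => //.
by rewrite /signed_product big_cat.
Qed.

Fact generatedV : invg_closed generated.
Proof.
move=> _ /asboolP[s _ <-]; apply/asboolP.
exists (rev [seq (a.1, ~~ a.2) | a <- s]) => //.
elim: s => [|[i b] s IHs]; first by rewrite /signed_product !big_nil invg1.
rewrite /= rev_cons -cats1 /signed_product big_cat big_seq1 /=.
rewrite -/(signed_product _) IHs /signed_product big_cons invgM /=.
by case: b; rewrite ?invgK.
Qed.

Definition generated_group : groupClosed G := @GroupClosed.Pack G generated
  (@GroupClosed.Class G generated (isInvClosed.Build G generated generatedV)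
     (isMul1Closed.Build G generated generated1)
     (isMulClosed.Build G generated generatedM)).

Lemma mem_generated i : F i \in generated_group.
Proof.
by apply/asboolP; exists [:: (i, false)] => //; rewrite /signed_product big_seq1.
Qed.
End GeneratedSubgroup.

Lemma countable_generated (G : groupType) (I : countType) (F : I -> G) :
  countable [set` generated_group F].
Proof.
rewrite (_ : [set` _] = range (signed_product F)).
  by apply: card_le_trans (card_image_le _ _) _; exact: countableP.
by apply/seteqP; split=> x /asboolP.
Qed.

(** * Passing between a group and its countable subgroups *)

Lemma infinite_set_seq T (A : set T) :
  infinite_set A -> exists2 e : nat -> T, injective e & forall n, A (e n).
Proof.
move=> /infiniteP/card_leP/unsquash e.
pose nat_in (n : nat) : [set: nat] := exist _ n (mem_set (I : [set: nat] n)).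
exists (fun n => val (e (nat_in n))) => [m n /val_inj|n]; last exact: set_valP.
by move=> /inj-/(_ (mem_set I) (mem_set I))/(congr1 val).
Qed.

(** An abstract form of subbasic sets defined by finitely many parameters: no
    syntax of descriptions is fixed, only the effect of changing the group, with
    [c] in the role of the parameters of [A]. *)
Section CountableSubgroups.
Variable subbase : forall G : groupType, set (set G).
Hypothesis subbase1 : forall (G : groupType) (a : G), subbase [set a].
Hypothesis subbase_trace : forall (G : groupType) (H : groupClosed G) A,
  @subbase (subgroup_type H) A -> exists2 B, @subbase G B & A = val @^-1` B.
Hypothesis subbase_restrict : forall (G : groupType) A, @subbase G A ->
  exists c : seq G, forall H : groupClosed G, {subset c <= H} ->
    @subbase (subgroup_type H) (val @^-1` A).

Local Notation cofinite G :=
  (cofinite_topology (closed_subbase_space (@subbase G))).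

Lemma cofinite_subgroup (G : groupType) (H : groupClosed G) :
  cofinite G -> cofinite (subgroup_type H).
Proof.
move=> /(cofinite_closed_subbaseP (@subbase1 _)) cofG.
apply/(cofinite_closed_subbaseP (@subbase1 _)) => A.
move=> /subbase_trace[B SB ->]; have [->|finB] := cofG B SB; first by left.
by right; apply: finite_preimage => // x y _ _; exact: val_inj.
Qed.

(** An infinite subbasic set that misses a point is already seen in a countable
    subgroup: it suffices to generate by its parameters, the missed point and
    a sequence of distinct elements of the set. *)
Lemma cofinite_countable_subgroups (G : groupType) :
  cofinite G <->
  (forall H : groupClosed G, countable [set` H] -> cofinite (subgroup_type H)).
Proof.
split=> [cofG H _|cofH]; first exact: cofinite_subgroup.
apply/(cofinite_closed_subbaseP (@subbase1 _)) => A SA.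
have [|infA] := pselect (finite_set A); first by right.
left; apply/seteqP; split=> // z _.
have [e e_inj Ae] := infinite_set_seq infA.
have [c c_spec] := subbase_restrict SA.
pose F (i : option (nat + nat)) :=
  match i with
  | None => z
  | Some (inl n) => e n
  | Some (inr n) => nth 1 c n
  end.
pose H := generated_group F.
have cH : {subset c <= H}.
  by move=> _ /(nthP 1)[n _ <-]; exact: (mem_generated F (Some (inr n))).
have eH n : e n \in H by exact: (mem_generated F (Some (inl n))).
have zH : z \in H by exact: (mem_generated F None).
have /(cofinite_closed_subbaseP (@subbase1 _)) := cofH H (countable_generated F).
move=> /(_ _ (c_spec H cH))[traceT|trace_fin].
  have : [set: subgroup_type H] (exist _ z zH) by [].
  by rewrite -traceT.
pose eK n : subgroup_type H := exist _ (e n) (eH n).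
case: infinite_nat.
rewrite (_ : [set: nat] = eK @^-1` (val @^-1` A)); last first.
  by apply/seteqP; split=> n // _; exact: Ae.
by apply: finite_preimage => // m n _ _ /(congr1 val); exact: e_inj.
Qed.
End CountableSubgroups.

(** * The three subbases *)

Lemma zariski_set1 (G : groupType) (a : G) : zariski_subbase [set a].
Proof.
(* The word [x * a^-1]. *)
exists (fp_inr G (Posz 1 : infinite_cyclic) * fp_inl infinite_cyclic a^-1)=> //.
apply/seteqP; split=> g; rewrite /solution_set /=.
  rewrite (word_eval_morphism g).2 word_eval_var word_eval_const /= expg1.
  by move=> /(canRL (mulgVK _)); rewrite mul1g.
by move=> ->; rewrite (word_eval_morphism a).2 word_eval_var word_eval_const /=
  expg1 mulgV.
Qed.

Lemma centralizer_set1 (G : groupType) (a : G) : centralizer_subbase [set a].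
Proof. by left; exists a. Qed.

Lemma monomial_set1 (G : groupType) (a : G) : monomial_subbase [set a].
Proof.
exists a^-1, 1%N; apply/seteqP; split=> x /=; rewrite expg1.
  by move->; rewrite mulVg.
by move=> /(canRL (mulVKg _)); rewrite mulg1.
Qed.

(** * Traces of the subbasic sets on a subgroup *)

Section Subgroup.
Variables (G : groupType) (H : groupClosed G).
Local Notation K := (subgroup_type H).

Lemma val_gexpz (h : K) n : val (gexpz h n) = gexpz (val h) n.
Proof. by case: n => n; rewrite /gexpz ?gmulfXn ?gmulfXVn. Qed.

Definition letter_val (a : K + infinite_cyclic) : G + infinite_cyclic :=
  match a with inl h => inl (val h) | inr n => inr n end.

(** Stated on letter sequences, so that the morphism from [K[x]] to [G[x]]
    induced by the inclusion is just [letter_val] applied letter by letter. *)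
Lemma val_word_eval (u : seq (K + infinite_cyclic)) h :
  val (word_eval (fp_class u) h) =
  word_eval (fp_class [seq letter_val a | a <- u]) (val h).
Proof.
rewrite /word_eval !fp_case_class //; try exact: gexpz_morphism.
rewrite big_map.
elim: u => [|a u IHu]; first by rewrite !big_nil.
rewrite !big_cons /= IHu; congr (_ * _).
by case: a => a //=; rewrite val_gexpz.
Qed.

(** The point is that when [x = val h * c] lies in the subgroup, so does
    [c = (val h)^-1 * x]: the centralizing factor needs no larger group. *)
Lemma val_coset (g h : K) :
  [set h * c | c in centralizer g] =
  val @^-1` [set val h * c | c in centralizer (val g)].
Proof.
apply/seteqP; split=> [_ [c cg <-]|x [c cg xE]].
  exists (val c); last by rewrite gmulfM.
  exact: (@gmulf_commute _ _ (val : K -> G)).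
have cE : val (h^-1 * x) = c.
  by rewrite gmulfM gmulfV; exact: (canLR (mulKg _) (esym xE)).
exists (h^-1 * x); last by rewrite mulVKg.
have comm : val (h^-1 * x) * val g = val g * val (h^-1 * x) by rewrite cE.
by apply: val_inj; rewrite [LHS]gmulfM [RHS]gmulfM.
Qed.

Lemma val_monomial (g : K) n :
  [set x | g * x ^+ n = 1] = val @^-1` [set x | val g * x ^+ n = 1].
Proof.
apply/seteqP; split=> x => [/(congr1 val)|gx]; first by rewrite gmulfM gmulfXn.
by apply: val_inj; rewrite gmulfM gmulfXn gx.
Qed.

Lemma zariski_trace (A : set K) :
  zariski_subbase A -> exists2 B, @zariski_subbase G B & A = val @^-1` B.
Proof.
move=> [w _ <-]; set w' := fp_class [seq letter_val a | a <- repr w].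
exists (solution_set w'); first by exists w'.
apply/seteqP; split=> h; rewrite /solution_set /=.
  by rewrite -val_word_eval fp_classK => ->.
by rewrite -val_word_eval fp_classK => e; apply: val_inj; rewrite e.
Qed.

Definition coefficients (u : seq (G + infinite_cyclic)) : seq G :=
  pmap (fun a => if a is inl g then Some g else None) u.

(** The finitely many coefficients of a word are the parameters of its solution
    set: a subgroup that contains them already carries the whole word. *)
Lemma word_lift (u : seq (G + infinite_cyclic)) :
  {subset coefficients u <= H} ->
  exists v : seq (K + infinite_cyclic), [seq letter_val a | a <- v] = u.
Proof.
elim: u => [_|[g|n] u IHu uH]; first by exists [::].
  have [|v vE] := IHu.
    by move=> x xu; apply: uH; rewrite inE xu orbT.
  have gH : g \in H by apply: uH; rewrite inE eqxx.
  by exists (inl (exist _ g gH) :: v); rewrite /= vE.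
by have [//|v vE] := IHu; exists (inr n :: v); rewrite /= vE.
Qed.

Lemma centralizer_trace (A : set K) :
  centralizer_subbase A ->
  exists2 B, @centralizer_subbase G B & A = val @^-1` B.
Proof.
case=> [[a ->]|[g [h ->]]].
  exists [set val a]; first by left; exists (val a).
  by apply/seteqP; split=> x /= => [->//|/val_inj].
exists [set val h * c | c in centralizer (val g)].
  by right; exists (val g), (val h).
by rewrite val_coset.
Qed.

Lemma monomial_trace (A : set K) :
  monomial_subbase A -> exists2 B, @monomial_subbase G B & A = val @^-1` B.
Proof.
move=> [g [n ->]]; exists [set x | val g * x ^+ n = 1].
  by exists (val g), n.
by rewrite val_monomial.
Qed.
End Subgroup.

Lemma zariski_restrict (G : groupType) (A : set G) : zariski_subbase A ->
  exists c : seq G, forall H : groupClosed G, {subset c <= H} ->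
    @zariski_subbase (subgroup_type H) (val @^-1` A).
Proof.
move=> [w _ <-]; exists (coefficients (repr w)) => H /word_lift[v vE].
exists (fp_class v) => //; apply/seteqP; split=> h; rewrite /solution_set /=.
  by move=> /(congr1 val); rewrite val_word_eval vE fp_classK.
by move=> wh; apply: val_inj; rewrite val_word_eval vE fp_classK wh.
Qed.

Lemma centralizer_restrict (G : groupType) (A : set G) :
  centralizer_subbase A ->
  exists c : seq G, forall H : groupClosed G, {subset c <= H} ->
    @centralizer_subbase (subgroup_type H) (val @^-1` A).
Proof.
case=> [[a ->]|[g [h ->]]].
  exists [:: a] => H aH; have {}aH : a \in H by apply: aH; rewrite inE.
  left; exists (exist _ a aH).
  by apply/seteqP; split=> x /= => [xa|->//]; apply: val_inj.
exists [:: g; h] => H cH.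
have gH : g \in H by apply: cH; rewrite !inE eqxx.
have hH : h \in H by apply: cH; rewrite !inE eqxx orbT.
by right; exists (exist _ g gH), (exist _ h hH); rewrite val_coset.
Qed.

Lemma monomial_restrict (G : groupType) (A : set G) : monomial_subbase A ->
  exists c : seq G, forall H : groupClosed G, {subset c <= H} ->
    @monomial_subbase (subgroup_type H) (val @^-1` A).
Proof.
move=> [g [n ->]]; exists [:: g] => H gH.
have {}gH : g \in H by apply: gH; rewrite inE.
by exists (exist _ g gH), n; rewrite val_monomial.
Qed.

Theorem theorem2p7 (G : groupType) (Ginf : infinite_set [set: G]) :
  [/\ zariski_cofinite G <->
        (forall H : groupClosed G, countable [set` H] ->
           zariski_cofinite (subgroup_type H)),
      centralizer_cofinite G <->
        (forall H : groupClosed G, countable [set` H] ->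
           centralizer_cofinite (subgroup_type H)) &
      monomial_cofinite G <->
        (forall H : groupClosed G, countable [set` H] ->
           monomial_cofinite (subgroup_type H))].
Proof.
split.
- exact: (cofinite_countable_subgroups zariski_set1 zariski_trace
    zariski_restrict).
- exact: (cofinite_countable_subgroups centralizer_set1 centralizer_trace
    centralizer_restrict).
- exact: (cofinite_countable_subgroups monomial_set1 monomial_trace
    monomial_restrict).
Qed.
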